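(* Let $p$ be a positive integer with $p\neq 2$, and let $G$ be a connected $\mathbf{W}_{p}$ graph. Then $G$ is $p$-quasi-regularizable if and only if $n(G)\geq (p+1)\cdot\alpha(G)$.
   Context: All graphs are finite, simple, undirected and loopless; $n(G)$ is the number of vertices. An independent set is a set of pairwise non-adjacent vertices; $\alpha(G)$ is the maximum size of an independent set, and a maximum independent set is one of size $\alpha(G)$. For $S\subseteq V(G)$, $N_G(S)$ is the set of vertices outside $S$ adjacent to some vertex of $S$. For $\lambda>0$, $G$ is $\lambda$-quasi-regularizable if $\lambda\cdot|S|\leq |N_G(S)|$ for every independent set $S$ of $G$. For a positive integer $p$, $G$ is a $\mathbf{W}_{p}$ graph if $n(G)\geq p$ and for every $p$ pairwise disjoint independent sets $A_1,\ldots,A_p$ of $G$ there exist $p$ pairwise disjoint maximum independent sets $S_1,\ldots,S_p$ of $G$ with $A_i\subseteq S_i$ for $1\le i\le p$. *)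

(* Defs.v *)
From HB Require Import structures.
From mathcomp Require Import all_boot all_order all_algebra.
Set Implicit Arguments.
Unset Strict Implicit.
Unset Printing Implicit Defensive.

(* A finite simple graph is a symmetric irreflexive relation [e] on a finite
   type [T] of vertices; both properties are hypotheses of the theorems. *)
Section Graphs.
Variables (T : finType) (e : rel T).

Definition connected_graph : Prop :=
  0 < #|T| /\ forall x y : T, connect e x y.

Definition independent (S : {set T}) : bool :=
  [forall x in S, forall y in S, ~~ e x y].

Definition alpha : nat := \max_(S : {set T} | independent S) #|S|.

Definition max_independent (S : {set T}) : bool :=
  independent S && (#|S| == alpha).

Definition nbhd (S : {set T}) : {set T} :=
  [set v | (v \notin S) && [exists u in S, e u v]].

Definition quasi_regularizable (R : realFieldType) (lambda : R) : Prop :=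
  forall S : {set T}, independent S ->
    (lambda * #|S|%:R <= #|nbhd S|%:R)%R.

(* Families are indexed by ['I_p], so distinct indices may both carry the
   empty set. *)
Definition pairwise_disjoint (p : nat) (A : 'I_p -> {set T}) : Prop :=
  forall i j : 'I_p, i != j -> [disjoint A i & A j].

Definition W_graph (p : nat) : Prop :=
  p <= #|T| /\
  forall A : 'I_p -> {set T},
    (forall i, independent (A i)) -> pairwise_disjoint A ->
    exists S : 'I_p -> {set T},
      [/\ forall i, max_independent (S i),
          pairwise_disjoint S
        & forall i, A i \subset S i].

End Graphs.

(* Main.v *)
(** Let D(K) be the set of vertices outside the closed neighbourhood of K. In a
W_p graph, every induced subgraph on D(K), with K independent, has minimum
degree at least p - 1 (its p disjoint maximum independent sets all meet the
closed neighbourhood of each vertex).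

Let S be an independent set violating (p+1)|S| <= |N[S]|, minimal for inclusion.
Minimality and the degree bound force every a in S to have exactly p - 1 private
neighbours, forming with a a clique Q_a without neighbours outside N[S], and
leave |S| - 1 vertices of N[S] "shared" by several elements of S. Localizing at
all but two elements a, b of a maximum independent set containing S gives a
graph of independence number 2, where each vertex has at least p non-neighbours;
for p <> 2 this excludes exactly one vertex shared by a and b there, and if there
is none then Q_a and Q_b are not joined. Two or more such vertices for some pair
would give a smaller violator, so the cliques are pairwise not joined. Then S and
the shared vertices behave like a well-covered graph, in which an independent set
has at least as many neighbours as elements unless it contains an isolated vertex;
hence |S| = 1, and Q_a is a connected component with p vertices, against the
assumption on the order of the graph. *)

Require Import Defs.
From mathcomp Require Import all_boot all_order all_algebra.
From mathcomp Require Import zify.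

Set Implicit Arguments.
Unset Strict Implicit.
Unset Printing Implicit Defensive.

(** * Counting over finite sets *)

Lemma double_count (I J : finType) (A : {set I}) (B : {set J}) (r : I -> J -> bool) :
  \sum_(i in A) #|[set j in B | r i j]| = \sum_(j in B) #|[set i in A | r i j]|.
Proof.
under eq_bigr do rewrite -sum1dep_card.
under [RHS]eq_bigr do rewrite -sum1dep_card.
rewrite (exchange_big_dep (mem B)) //=; last by move=> i j _ /andP[].
by apply: eq_bigr => j jB; apply: eq_bigl => i; rewrite jB.
Qed.

Lemma leq_card_bigcup (I J : finType) (A : {set I}) (F : I -> {set J}) :
  #|\bigcup_(i in A) F i| <= \sum_(i in A) #|F i|.
Proof.
elim/big_rec2: _ => [|i n B _ IH]; first by rewrite cards0.
by apply: leq_trans (leq_card_setU _ _) _; rewrite leq_add2l.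
Qed.

(** * Closed neighbourhoods and independent sets *)

Section Domination.
Variables (T : finType) (e : rel T).
Hypotheses (e_sym : symmetric e) (e_irr : irreflexive e).
Implicit Types (u v x y : T) (A B K J X S : {set T}).

Definition cadj u v := (u == v) || e u v.

Definition undominated K := [set v | [forall u in K, ~~ cadj u v]].
Local Notation D := undominated.

Lemma cadjC u v : cadj u v = cadj v u.
Proof. by rewrite /cadj eq_sym e_sym. Qed.

Lemma cadjxx u : cadj u u.
Proof. by rewrite /cadj eqxx. Qed.

Lemma undominatedP K v :
  reflect (forall u, u \in K -> ~~ cadj u v) (v \in D K).
Proof. by rewrite inE; apply: (iffP forall_inP). Qed.

Lemma dominatedP K v : reflect (exists2 u, u \in K & cadj u v) (v \notin D K).
Proof.
rewrite inE negb_forall; apply: (iffP existsP) => [[u]|[u uK uv]].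
  by rewrite negb_imply negbK => /andP[uK uv]; exists u.
by exists u; rewrite negb_imply uK uv.
Qed.

Lemma undominatedU A B : D (A :|: B) = D A :&: D B.
Proof.
apply/setP=> v; rewrite in_setI; apply/undominatedP/andP.
  by move=> h; split; apply/undominatedP=> u uA; apply: h; rewrite inE uA ?orbT.
by case=> /undominatedP hA /undominatedP hB u /setUP[/hA|/hB].
Qed.

Lemma undominated1 u v : (v \in D [set u]) = ~~ cadj u v.
Proof.
apply/undominatedP/idP => [-> //|uv x]; first by rewrite set11.
by rewrite inE => /eqP->.
Qed.

Lemma undominatedS A B : A \subset B -> D B \subset D A.
Proof.
move=> /subsetP sAB; apply/subsetP => v /undominatedP h.
by apply/undominatedP => u /sAB; apply: h.
Qed.

Lemma notin_undominated K v : v \in K -> v \notin D K.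
Proof. by move=> vK; apply/dominatedP; exists v => //; rewrite cadjxx. Qed.

Lemma independentP A :
  reflect {in A &, forall x y, x != y -> ~~ cadj x y} (independent e A).
Proof.
apply: (iffP forall_inP) => [h x y xA yA xy | h x xA].
  by rewrite /cadj (negbTE xy); apply: (forall_inP (h x xA)).
apply/forall_inP=> y yA; have [->|xy] := eqVneq x y; first by rewrite e_irr.
by have := h x y xA yA xy; rewrite /cadj negb_or => /andP[].
Qed.

Lemma independentS A B : A \subset B -> independent e B -> independent e A.
Proof.
move=> /subsetP sAB /independentP h; apply/independentP=> x y /sAB xB /sAB yB.
exact: h.
Qed.

Lemma independent0 : independent e set0.
Proof. by apply/independentP => x y; rewrite inE. Qed.

Lemma independent1 x : independent e [set x].
Proof. by apply/independentP => u v /set1P-> /set1P->; rewrite eqxx. Qed.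

Lemma independentU A B : independent e A -> independent e B ->
  B \subset D A -> independent e (A :|: B).
Proof.
move=> /independentP iA /independentP iB /subsetP sBD.
apply/independentP => x y /setUP[xA|xB] /setUP[yA|yB] xy.
- exact: iA.
- exact: (undominatedP _ _ (sBD y yB)).
- by rewrite cadjC; apply: (undominatedP _ _ (sBD x xB)).
- exact: iB.
Qed.

Lemma independentU1 K x : independent e K -> x \in D K -> independent e (x |: K).
Proof.
move=> iK xD; rewrite setUC; apply: independentU => //.
  exact: independent1.
by rewrite sub1set.
Qed.

Lemma independent_undominated A B :
  independent e A -> B \subset A -> A :\: B \subset D B.
Proof.
move=> /independentP iA /subsetP sBA; apply/subsetP => v /setDP[vA vB].
apply/undominatedP=> u uB; apply: iA => //; first exact: sBA.
by apply: contraNneq vB => <-.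
Qed.

Lemma independent_undominated1 A a :
  independent e A -> a \in A -> a \in D (A :\ a).
Proof.
move=> iA aA; apply: (subsetP (independent_undominated iA (subsetDl _ _))).
by rewrite !inE eqxx aA.
Qed.

Lemma card_independent A : independent e A -> #|A| <= alpha e.
Proof. by move=> iA; apply: (bigmax_sup A). Qed.

(** Translates [p * #|A| <= #|nbhd e A|] into [p.+1 * #|A| <= #|~: D A|], the form used
    throughout. *)
Lemma card_dominated A : independent e A -> #|~: D A| = #|A| + #|nbhd e A|.
Proof.
move=> iA; rewrite -cardsUI.
have -> : A :&: nbhd e A = set0.
  by apply/setP=> v; rewrite !inE; case: (v \in A).
rewrite cards0 addn0; apply: eq_card => v; rewrite in_setC.
apply/dominatedP/setUP => [[u uA]|[vA|]].
- rewrite /cadj; have [<-|uv] := eqVneq u v; first by left.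
  have [vA|vA] := boolP (v \in A); first by left.
  move=> /= euv; right; rewrite inE vA; apply/existsP.
  by exists u; rewrite uA euv.
- by exists v; rewrite ?cadjxx.
- rewrite inE => /andP[_ /exists_inP[u uA uv]]; exists u => //.
  by rewrite /cadj uv orbT.
Qed.

Lemma max_independent_dominates J : max_independent e J -> D J = set0.
Proof.
case/andP=> iJ /eqP cJ; apply/setP=> v; rewrite in_set0.
apply/negbTE/negP=> vD.
have := card_independent (independentU1 iJ vD).
have vJ : v \notin J by apply: contraL vD => /notin_undominated.
by rewrite cardsU1 vJ cJ; lia.
Qed.

(** Exchanging the part of [J] dominated by [S] for [S] itself keeps independence, so it cannot
    enlarge the maximum set [J]. *)
Lemma card_dominated_part J S : max_independent e J -> independent e S ->
  #|S| <= #|J :\: D S|.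
Proof.
case/andP=> iJ /eqP cJ iS.
have sub : J :&: D S \subset D S by apply: subsetIr.
have := card_independent (independentU iS (independentS (subsetIl J (D S)) iJ) sub).
have -> : #|S :|: J :&: D S| = #|S| + #|J :&: D S|.
  rewrite -cardsUI; have -> : S :&: (J :&: D S) = set0; last by rewrite cards0 addn0.
  apply/setP=> v; rewrite !in_setI in_set0; apply/negbTE/negP.
  by case/and3P=> /notin_undominated/negbTE->.
by rewrite -cJ -(cardsID (D S) J); lia.
Qed.

(** * Localization in a [W_graph] *)

Section Wp.
Variable p : nat.
Hypotheses (p_gt0 : 0 < p) (GW : W_graph e p).

(** The family extended has [A] at one index and the empty set at all others. *)
Lemma extend_max A : independent e A ->
  exists2 J, max_independent e J & A \subset J.
Proof.
move=> iA; case: GW => _.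
pose i0 := Ordinal p_gt0.
move=> /(_ (fun i => if i == i0 then A else set0)) []; first 1 last.
- move=> i j ij; case: eqP => [i_|_]; last by rewrite disjoints_subset sub0set.
  case: eqP => [j_|_]; first by rewrite i_ j_ eqxx in ij.
  by rewrite disjoint_sym disjoints_subset sub0set.
- move=> S [maxS _ sub]; exists (S i0) => //.
  by have := sub i0; rewrite eqxx.
- by move=> i; case: ifP => // _; apply: independent0.
Qed.

(* Being disjoint, the sets cannot all be extended together with K; they are
   obtained one at a time, K being attached to a different index each time. *)
Lemma localize K : independent e K ->
  exists B : 'I_p -> {set T},
    pairwise_disjoint B /\
    forall i, [/\ B i \subset D K, independent e (B i)
                & #|B i| + #|K| = alpha e].
Proof.
move=> iK.
suff H k : k <= p -> exists B : 'I_p -> {set T},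
    pairwise_disjoint B /\
    forall i, [/\ B i \subset D K, independent e (B i)
                & if i < k then #|B i| + #|K| = alpha e else B i = set0].
  have [B [dB hB]] := H p (leqnn p); exists B; split=> // i.
  by case: (hB i); rewrite ltn_ord.
elim: k => [_|k IHk kp].
  exists (fun=> set0); split=> [i j _|i]; first by rewrite disjoints_subset sub0set.
  by rewrite ltn0 sub0set independent0.
have [B [dB hB]] := IHk (ltnW kp).
pose i0 := Ordinal kp.
have B0 : B i0 = set0 by case: (hB i0); rewrite ltnn.
have KB i : [disjoint K & B i].
  rewrite disjoints_subset; apply/subsetP=> v vK; rewrite in_setC.
  case: (hB i) => /subsetP sB _ _; apply/negP=> /sB.
  by apply/negP/notin_undominated.
(* Index [k] still carries the empty set, so placing [K] there loses nothing. *)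
case: GW => _ /(_ (fun i => if i == i0 then K else B i)) [].
- by move=> i; case: ifP => // _; case: (hB i).
- move=> i j ij; case: eqP => [i_|_]; case: eqP => [j_|_] //; last exact: dB.
  + by rewrite i_ j_ eqxx in ij.
  + by rewrite disjoint_sym.
move=> J [maxJ dJ sub].
have /andP[iJ0 /eqP cJ0] := maxJ i0.
have sKJ : K \subset J i0 by have := sub i0; rewrite eqxx.
(* Only the set at index [k] changes; the other [J i] contain the [B i] and so certify
   disjointness. *)
exists (fun i => if i == i0 then J i0 :\: K else B i); split.
  have dB0 i : i != i0 -> [disjoint J i0 :\: K & B i].
    move=> ii0; apply: disjointWl (subsetDl _ _) _.
    have := sub i; rewrite (negbTE ii0) => /disjointWr; apply.
    by apply: dJ; rewrite eq_sym.
  move=> i j ij; case: eqP => [i_|/eqP ni]; case: eqP => [j_|/eqP nj].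
  + by rewrite i_ j_ eqxx in ij.
  + exact: dB0.
  + by rewrite disjoint_sym; apply: dB0.
  + exact: dB.
move=> i; case: eqP => [->|/eqP ni].
  split; [exact: independent_undominated | exact: independentS (subsetDl _ _) iJ0|].
  by rewrite ltnSn cardsD (setIidPr sKJ) cJ0 subnK // -cJ0 subset_leq_card.
case: (hB i) => h1 h2 h3; split=> //.
have -> // : (i < k.+1) = (i < k).
by rewrite ltnS leq_eqVlt; case: eqP => // ik; case/eqP: ni; apply: val_inj.
Qed.

(** Each [K :|: B i] is maximum, hence dominating, while [K] does not dominate [x]; so each of the
    [p] disjoint sets [B i] meets the closed neighbourhood of [x]. *)
Lemma degree_localized K x : independent e K -> x \in D K ->
  p <= #|[set v in D K | cadj x v]|.
Proof.
move=> iK xD; have [B [dB hB]] := localize iK.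
have hit i : exists v, (v \in B i) && cadj x v.
  case: (hB i) => sB iB cB.
  have maxKB : max_independent e (K :|: B i).
    rewrite /max_independent independentU //= -cB addnC; apply/eqP.
    rewrite -cardsUI; have -> : K :&: B i = set0; last by rewrite cards0 addn0.
    apply/setP=> v; rewrite in_setI in_set0; apply/negbTE/negP.
    by case/andP=> /notin_undominated/negP + /(subsetP sB).
  have : x \notin D (K :|: B i) by rewrite (max_independent_dominates maxKB) inE.
  rewrite undominatedU in_setI xD => /dominatedP[v vB vx].
  by exists v; rewrite vB cadjC.
pose f i := xchoose (hit i).
have fP i : (f i \in B i) && cadj x (f i) by apply: (xchooseP (hit i)).
have f_inj : injective f.
  move=> i j fij; apply/eqP; apply: contraT => /dB dij.
  have /andP[fi _] := fP i; have /andP[fj _] := fP j.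
  by rewrite fij in fi; have /pred0P/(_ (f j)) := dij; rewrite /= fi fj.
rewrite -{1}(card_ord p) -(card_codom f_inj); apply: subset_leq_card.
apply/subsetP => _ /codomP[i ->]; rewrite inE.
by have /andP[fi ->] := fP i; case: (hB i) => /subsetP/(_ _ fi) ->.
Qed.

(** Two distinct non-adjacent vertices of [D K] would extend [K] beyond size [alpha e]. *)
Lemma clique_localized K : independent e K -> #|K|.+1 = alpha e ->
  {in D K &, forall x y, cadj x y}.
Proof.
move=> iK cK x y xD yD; apply: contraT => nxy.
have xK : x \notin K by apply: contraL xD => /notin_undominated.
have iK1 := independentU1 iK xD.
have y1 : y \in D (x |: K) by rewrite undominatedU in_setI yD undominated1 nxy.
have y1N : y \notin x |: K by apply: contraL y1 => /notin_undominated.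
have := card_independent (independentU1 iK1 y1).
by rewrite !cardsU1 xK y1N -cK; clear; lia.
Qed.

(** * Minimal violators, private and shared vertices *)

Section MinimalViolator.
Variable S : {set T}.
Hypotheses (iS : independent e S)
  (minS : forall X, X \proper S -> p.+1 * #|X| <= #|~: D X|)
  (violS : #|~: D S| < p.+1 * #|S|).

Definition private a := D (S :\ a) :\: D S.
Definition shared := ~: D S :\: \bigcup_(a in S) private a.

Lemma in_private a v : a \in S ->
  (v \in private a) = (v \in D (S :\ a)) && cadj a v.
Proof.
move=> aS; rewrite in_setD andbC; have [vD|//] := boolP (v \in D (S :\ a)).
by rewrite -{1}(setD1K aS) undominatedU in_setI vD undominated1 andbT negbK.
Qed.

Lemma self_private a : a \in S -> a \in private a.
Proof.
by move=> aS; rewrite in_private // cadjxx independent_undominated1.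
Qed.

(** Passing from [S :\ a] to [S] adds the private vertices of [a], at least [p] by the degree bound,
    to at least [p.+1 * (#|S| - 1)] dominated ones. The violation leaves no room for more, so both
    bounds are equalities. *)
Lemma card_private_dominated a : a \in S ->
  #|private a| = p /\ #|~: D S|.+1 = p.+1 * #|S|.
Proof.
move=> aS.
have geP : p <= #|private a|.
  have iSa := independentS (subsetDl S [set a]) iS.
  apply: leq_trans (degree_localized iSa (independent_undominated1 iS aS)) _.
  by apply: subset_leq_card; apply/subsetP=> v; rewrite inE in_private.
have sD : D S \subset D (S :\ a) by apply: undominatedS; apply: subsetDl.
have := minS (properD1 aS).
have : #|private a| + #|D S| = #|D (S :\ a)|.
  by rewrite cardsD (setIidPr sD) subnK // subset_leq_card.
have := cardsC (D S); have := cardsC (D (S :\ a)).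
have := cardsD1 a S; rewrite aS.
by move: violS geP; nia.
Qed.

Lemma card_private a : a \in S -> #|private a| = p.
Proof. by case/card_private_dominated. Qed.

(** [D (J :\ a)] lies in [private a], and by the degree bound it has at least the [p] elements of
    that set. *)
Lemma private_max J a : max_independent e J -> S \subset J -> a \in S ->
  D (J :\ a) = private a.
Proof.
move=> maxJ sSJ aS; have aJ := subsetP sSJ a aS; have /andP[iJ _] := maxJ.
apply/eqP; rewrite eqEcard card_private //; apply/andP; split.
  apply/subsetP=> v vD; rewrite in_private //.
  rewrite (subsetP (undominatedS (setSD _ sSJ))) //=.
  have : v \notin D J by rewrite max_independent_dominates // inE.
  by rewrite -(setD1K aJ) undominatedU in_setI vD andbT undominated1 negbK.
have iJa := independentS (subsetDl J [set a]) iJ.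
apply: leq_trans (degree_localized iJa (independent_undominated1 iJ aJ)) _.
by apply: subset_leq_card; apply/subsetP=> v; rewrite inE => /andP[].
Qed.

Lemma private_clique a : a \in S -> {in private a &, forall x y, cadj x y}.
Proof.
move=> aS; have [J maxJ sSJ] := extend_max iS.
rewrite -(private_max maxJ sSJ aS); have /andP[iJ /eqP cJ] := maxJ.
apply: clique_localized; first exact: independentS (subsetDl _ _) iJ.
by rewrite -cJ (cardsD1 a J) (subsetP sSJ).
Qed.

(** For a maximum set [J] containing both [S] and [c], [private a] is [D (J :\ a)], and [c] belongs
    to [J :\ a]. *)
Lemma private_out a x c : a \in S -> x \in private a -> c \in D S -> ~~ cadj x c.
Proof.
move=> aS xP cD.
have [J maxJ sJ] := extend_max (independentU1 iS cD).
have sSJ : S \subset J by apply: subset_trans sJ; apply: subsetUr.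
move: xP; rewrite -(private_max maxJ sSJ aS) cadjC // => /undominatedP; apply.
rewrite !inE (subsetP sJ) ?setU11 // andbT; apply: contraTneq cD => ->.
exact: notin_undominated.
Qed.

Lemma private_unique a b x : a \in S -> b \in S -> x \in private a -> cadj b x -> b = a.
Proof.
move=> aS bS; rewrite in_private // => /andP[/undominatedP xD _] bx.
apply/eqP; apply: contraLR bx => nba; apply: xD; first by rewrite !inE nba.
Qed.

Lemma dominated_cases v : v \notin D S ->
  v \in shared \/ exists2 a, a \in S & v \in private a.
Proof.
move=> vD; have [/bigcupP[a aS va]|nv] := boolP (v \in \bigcup_(a in S) private a).
  by right; exists a.
by left; rewrite in_setD nv in_setC.
Qed.

Lemma shared_not_private a v : a \in S -> v \in shared -> v \notin private a.
Proof.
move=> aS; rewrite in_setD => /andP[+ _]; apply: contra => vP.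
by apply/bigcupP; exists a.
Qed.

(** The disjoint private sets fill [p * #|S|] of the [p.+1 * #|S| - 1] dominated vertices. *)
Lemma card_shared : #|shared| < #|S|.
Proof.
have [a aS] : exists a, a \in S.
  by apply/set0Pn; apply: contraL violS => /eqP->; rewrite cards0 muln0.
have [_ cD] := card_private_dominated aS.
pose B := \bigcup_(a in S) private a.
have sB : B \subset ~: D S.
  by apply/bigcupsP => b bS; apply/subsetP=> v; rewrite in_setD in_setC => /andP[].
have : #|shared| + #|B| = #|~: D S|.
  by rewrite cardsD (setIidPr sB) subnK // subset_leq_card.
suff : p * #|S| <= #|B| by nia.
have -> : p * #|S| = \sum_(a in S) #|[set v in B | v \in private a]|.
  rewrite mulnC -sum_nat_const; apply: eq_bigr => b bS; rewrite -(card_private bS).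
  apply: eq_card => v; rewrite inE andbC; have [vP|//] := boolP (v \in private b).
  by apply/esym/bigcupP; exists b.
rewrite double_count -sum1_card; apply: leq_sum => v _.
apply/card_le1_eqP => b c /setIdP[bS bv] /setIdP[cS cv].
apply: (@private_unique b c v) => //.
by move: cv; rewrite in_private // => /andP[].
Qed.

Lemma card_dominated_shared X : X \subset S ->
  #|~: D X| <= #|shared :&: ~: D X| + p * #|X|.
Proof.
move=> /subsetP sXS.
have -> : p * #|X| = \sum_(a in X) #|private a|.
  by rewrite mulnC -sum_nat_const; apply: eq_bigr => a /sXS aS; rewrite card_private.
apply: leq_trans (leq_add (leqnn _) (leq_card_bigcup _ _)).
apply: leq_trans (leq_card_setU _ _); apply: subset_leq_card.
apply/subsetP=> v vD; move: (vD); rewrite in_setC => /dominatedP[u uX uv].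
have /dominated_cases[vs|[a aS va]] : v \notin D S.
- by apply/dominatedP; exists u => //; apply: sXS.
- by rewrite in_setU in_setI vs vD.
- rewrite in_setU; apply/orP; right; apply/bigcupP; exists a => //.
  by rewrite -(private_unique aS (sXS u uX) va uv).
Qed.

Hypothesis p_neq2 : p <> 2.

(** * Localization at all but two vertices of a maximum independent set *)

Section Pairs.
Variable J : {set T}.
Hypotheses (maxJ : max_independent e J) (sSJ : S \subset J).

Definition pair_region a b := D (J :\: [set a; b]).
Definition pair_shared a b := [set v in pair_region a b | cadj a v && cadj b v].

Lemma pair_regionC a b : pair_region a b = pair_region b a.
Proof. by rewrite /pair_region setUC. Qed.

Lemma pair_sharedC a b : pair_shared a b = pair_shared b a.
Proof.
rewrite /pair_shared pair_regionC; apply/setP=> v.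
by apply/setIdP/setIdP => -[-> /andP[-> ->]].
Qed.

Lemma private_pair_region a b : a \in S -> private a \subset pair_region a b.
Proof.
move=> aS; rewrite -(private_max maxJ sSJ aS); apply: undominatedS.
by apply: setDS; rewrite sub1set set21.
Qed.

Section Pair.
Variables a b : T.
Hypotheses (aS : a \in S) (bS : b \in S) (ab : a != b).
Local Notation E := (pair_region a b).
Local Notation L := (J :\: [set a; b]).

Let iJ : independent e J. Proof. by case/andP: maxJ. Qed.
Let cJ : #|J| = alpha e. Proof. by case/andP: maxJ => _ /eqP. Qed.
Let iL : independent e L. Proof. exact: independentS (subsetDl _ _) iJ. Qed.

Lemma card_pair_rest : #|L|.+2 = alpha e.
Proof.
have sJ : [set a; b] \subset J by rewrite subUset !sub1set !(subsetP sSJ).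
by rewrite -cJ -(cardsID [set a; b] J) (setIidPr sJ) cards2 ab.
Qed.

Lemma card_pair_extended x : x \in E -> #|x |: L|.+1 = alpha e.
Proof.
move=> xE; have xL : x \notin L by apply: contraL xE => /notin_undominated.
by rewrite cardsU1 xL -card_pair_rest.
Qed.

Lemma pair_nonadj_undominated x :
  [set v in E | ~~ cadj x v] = D (x |: L).
Proof. by apply/setP=> v; rewrite undominatedU in_setI undominated1 inE andbC. Qed.

(** These non-neighbours form [D (x |: L)]. As [x |: L] is one short of maximum, this set has an
    element, to which the degree bound applies. *)
Lemma card_pair_nonadj x : x \in E -> p <= #|[set v in E | ~~ cadj x v]|.
Proof.
move=> xE; rewrite pair_nonadj_undominated.
have ixL := independentU1 iL xE.
have [J' /andP[iJ' /eqP cJ'] sJ'] := extend_max ixL.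
have /card_gt0P[y yJ'] : 0 < #|J' :\: (x |: L)|.
  by rewrite cardsD (setIidPr sJ') cJ' -(card_pair_extended xE) subSnn.
have yD := subsetP (independent_undominated iJ' sJ') y yJ'.
apply: leq_trans (degree_localized ixL yD) _.
by apply: subset_leq_card; apply/subsetP=> v; rewrite inE => /andP[].
Qed.

Lemma pair_nonadj_clique x : x \in E ->
  {in [set v in E | ~~ cadj x v] &, forall y z, cadj y z}.
Proof.
move=> xE; rewrite pair_nonadj_undominated; apply: clique_localized.
  exact: independentU1.
exact: card_pair_extended.
Qed.

Lemma pair_region_cases v : v \in E ->
  [\/ v \in private a, v \in private b | v \in pair_shared a b].
Proof.
move=> vE.
have aux c d : c \in S -> d \in S -> c != d -> v \in pair_region c d ->
    ~~ cadj d v -> v \in private c.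
  move=> cS dS cd vE' dv; rewrite -(private_max maxJ sSJ cS).
  have -> : J :\ c = d |: (J :\: [set c; d]).
    apply/setP=> u; rewrite !inE negb_or; have [->|_] := eqVneq u d.
      by rewrite eq_sym cd (subsetP sSJ).
    by rewrite andbT.
  by rewrite undominatedU in_setI undominated1 dv.
have [bv|bv] := boolP (cadj b v); last by apply: Or31; apply: (aux a b).
have [av|av] := boolP (cadj a v).
  by apply: Or33; rewrite inE vE av bv.
by apply: Or32; apply: (aux b a); rewrite // 1?eq_sym // pair_regionC.
Qed.

Lemma private_nonadj x v : x \in private a -> v \in E -> ~~ cadj x v ->
  v \in private b \/ v \in pair_shared a b.
Proof.
move=> xP /pair_region_cases[vP|vP|vW]; [|by left|by right].
by rewrite (private_clique aS).
Qed.

(** The non-neighbours of [x] in [E] all lie in [private b]; being at least [p] in number, they fill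
    it. *)
Lemma pair_no_cross x y : pair_shared a b = set0 ->
  x \in private a -> y \in private b -> ~~ cadj x y.
Proof.
move=> W0 xP yP.
have xE := subsetP (private_pair_region b aS) x xP.
have sN : [set v in E | ~~ cadj x v] \subset private b.
  apply/subsetP=> v; rewrite inE => /andP[vE xv].
  by case: (private_nonadj xP vE xv) => //; rewrite W0 inE.
have /eqP eN : [set v in E | ~~ cadj x v] == private b.
  by rewrite eqEcard sN card_private // card_pair_nonadj.
by move: yP; rewrite -eN inE => /andP[].
Qed.

(** The non-neighbours of [w] form a clique, so [x] is adjacent to all those in [private b]. The at
    least [p] non-neighbours of [x] are then [w] and the rest of [private b] at most. *)
Lemma pair_single_nonadj w x : pair_shared a b = [set w] ->
  x \in private a -> ~~ cadj w x ->
  #|[set y in private b | ~~ cadj w y]| <= 1.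
Proof.
move=> W1 xP wx.
have xE := subsetP (private_pair_region b aS) x xP.
have wE : w \in E by have := set11 w; rewrite -W1 inE => /andP[].
have sbE := subsetP (private_pair_region a bS).
set B := [set y in private b | _].
have sN : [set v in E | ~~ cadj x v] \subset w |: (private b :\: B).
  apply/subsetP=> v; rewrite inE => /andP[vE xv].
  case: (private_nonadj xP vE xv) => [vb|]; last first.
    by rewrite W1 => /set1P->; rewrite setU11.
  rewrite in_setU1 in_setD vb andbT; apply/orP; right.
  apply: contra xv => /setIdP[_ wv].
  by apply: (pair_nonadj_clique wE); rewrite inE ?xE ?vE.
have sB : B \subset private b by apply/subsetP=> v; rewrite inE => /andP[].
have := leq_trans (card_pair_nonadj xE) (subset_leq_card sN).
have := subset_leq_card sB.
rewrite cardsU1 cardsD (setIidPr sB) card_private //.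
by case: (w \notin _) => /=; move: #|B| => k; clear; lia.
Qed.

End Pair.

(** The at least [p] non-neighbours of [w] split between [private a] and [private b], fewer than [p]
    in each since [a] and [b] dominate [w]. Hence both parts are nonempty, [pair_single_nonadj]
    bounds each by 1, and [p = 2]. *)
Lemma pair_shared_not_single a b w : a \in S -> b \in S -> a != b ->
  pair_shared a b <> [set w].
Proof.
move=> aS bS ab W1.
have /setIdP[wE /andP[wa wb]] : w \in pair_shared a b by rewrite W1 set11.
pose N c := [set y in private c | ~~ cadj w y].
have cN c : c \in S -> cadj c w -> #|N c| < p.
  move=> cS cw; rewrite -(card_private cS); apply: proper_card.
  apply/properP; split; first by apply/subsetP=> v; rewrite inE => /andP[].
  by exists c; [exact: self_private | rewrite inE cadjC // cw andbF].
have := card_pair_nonadj aS bS ab wE.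
have sN : [set v in pair_region a b | ~~ cadj w v] \subset N a :|: N b.
  apply/subsetP=> v; rewrite inE => /andP[vE wv]; rewrite in_setU.
  case: (pair_region_cases aS bS ab vE) => [va|vb|].
  - by apply/orP; left; apply/setIdP.
  - by apply/orP; right; apply/setIdP.
  by rewrite W1 => /set1P vw; rewrite vw cadjxx in wv.
move/leq_trans/(_ (subset_leq_card sN))/leq_trans/(_ (leq_card_setU _ _)).
have := cN a aS wa; have := cN b bS wb => ltb lta leN.
have /card_gt0P[x /setIdP[xP wx]] : 0 < #|N a|.
  by move: leN lta ltb; move: #|N a| #|N b| => m n; clear; lia.
have /card_gt0P[y /setIdP[yP wy]] : 0 < #|N b|.
  by move: leN lta ltb; move: #|N a| #|N b| => m n; clear; lia.
have := pair_single_nonadj aS bS ab W1 xP wx.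
have ba : b != a by rewrite eq_sym.
have := pair_single_nonadj bS aS ba (etrans (pair_sharedC b a) W1) yP wy.
rewrite -/(N a) -/(N b); move: leN lta ltb p_neq2.
by move: #|N a| #|N b| => m n; clear; lia.
Qed.

Lemma pair_shared_sub a b : a \in S -> b \in S -> a != b ->
  pair_shared a b \subset shared.
Proof.
move=> aS bS ab; apply/subsetP=> w /setIdP[_ /andP[aw bw]].
have wD : w \notin D S by apply/dominatedP; exists a.
case: (dominated_cases wD) => // -[c cS wP].
have ac := private_unique cS aS wP aw.
by move/eqP: ab; rewrite (private_unique cS bS wP bw) ac.
Qed.

Lemma pair_shared_dominator a b c w : c \in S -> w \in pair_shared a b ->
  cadj c w -> c \in [set a; b].
Proof.
move=> cS /setIdP[/undominatedP wE _] cw; apply: contraLR cw => cab.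
by apply: wE; rewrite in_setD cab (subsetP sSJ).
Qed.

(* The vertices of S involved in a nonempty pair_shared are no more numerous
   than the shared vertices they use up, so removing them from S would leave a
   smaller violator. *)
Lemma pair_shared0 a b : a \in S -> b \in S -> a != b -> pair_shared a b = set0.
Proof.
move=> aS bS ab; apply/eqP; apply: contraT => W_neq0.
pose C2 := \bigcup_(c in S) \bigcup_(d in S :\ c) pair_shared c d.
have C2P c d w : c \in S -> d \in S -> c != d -> w \in pair_shared c d -> w \in C2.
  move=> cS dS cd wW; apply/bigcupP; exists c => //; apply/bigcupP; exists d => //.
  by rewrite !inE eq_sym cd.
have C2E w : w \in C2 ->
    exists c d, [/\ c \in S, d \in S, c != d & w \in pair_shared c d].
  case/bigcupP=> c cS /bigcupP[d /setD1P[dc dS] wW]; exists c, d; split=> //.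
  by rewrite eq_sym.
pose U := [set c in S | [exists d in S :\ c, pair_shared c d != set0]].
have sUS : U \subset S by apply/subsetP=> c; rewrite inE => /andP[].
have aU : a \in U.
  by rewrite inE aS; apply/exists_inP; exists b; rewrite // !inE eq_sym ab.
have UP c d w : c \in S -> d \in S -> c != d -> w \in pair_shared c d -> c \in U.
  move=> cS dS cd wW; rewrite inE cS; apply/exists_inP; exists d.
    by rewrite !inE eq_sym cd.
  by apply/set0Pn; exists w.
have leUC2 : #|U| <= #|C2|.
  (* Doubling prepares a count of pairs: each vertex of [U] dominates at least two vertices of [C2],
     each dominated by at most two of [U]. *)
  rewrite -(leq_pmul2r (isT : 0 < 2)) -!sum_nat_const.
  apply: (@leq_trans (\sum_(c in U) #|[set w in C2 | cadj c w]|)).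
    apply: leq_sum => c /setIdP[cS /exists_inP[d /setD1P[dc dS] Wcd]].
    have cd : c != d by rewrite eq_sym.
    apply: (@leq_trans #|pair_shared c d|).
      rewrite leqNgt ltnS leq_eqVlt negb_or; apply/andP; split.
        by apply/negP=> /cards1P[w]; apply: pair_shared_not_single.
      by rewrite ltnS leqn0 cards_eq0.
    apply: subset_leq_card; apply/subsetP => w wW; rewrite inE (C2P c d) //.
    by move: wW; rewrite inE => /and3P[].
  rewrite double_count; apply: leq_sum => w /C2E[c [d [cS dS cd wW]]].
  apply: (@leq_trans #|[set c; d]|); last by rewrite cards2; case: (_ != _).
  apply: subset_leq_card; apply/subsetP=> u; rewrite inE => /andP[/(subsetP sUS) uS].
  exact: pair_shared_dominator.
have sC2 : C2 \subset shared.
  by apply/subsetP=> w /C2E[c [d [cS dS cd]]]; apply/subsetP/pair_shared_sub.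
have pX : S :\: U \proper S.
  apply/properP; split; first exact: subsetDl.
  by exists a; rewrite // in_setD aU.
have := minS pX; have := card_dominated_shared (proper_sub pX).
(* All dominators in [S] of a vertex of [C2] lie in [U], so [S :\: U] dominates nothing in [C2]. *)
have : #|shared :&: ~: D (S :\: U)| <= #|shared :\: C2|.
  apply: subset_leq_card; apply/subsetP=> w /setIP[ws wD].
  rewrite in_setD ws andbT; apply: contraL wD => /C2E[c [d [cS dS cd wW]]].
  rewrite in_setC negbK; apply/undominatedP => u /setDP[uS uU].
  apply: contra uU => /(pair_shared_dominator uS wW)/set2P[->|->].
    exact: UP wW.
  by rewrite pair_sharedC in wW; apply: UP wW; rewrite // eq_sym.
rewrite (cardsD S U) (cardsD shared C2) (setIidPr sUS) (setIidPr sC2) mulSn.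
move: (subset_leq_card sUS) (subset_leq_card sC2) card_shared leUC2.
by clear; lia.
Qed.

End Pairs.

(** * Reduction to a violator with one element *)

Lemma no_cross a b x y : a \in S -> b \in S -> a != b ->
  x \in private a -> y \in private b -> ~~ cadj x y.
Proof.
move=> aS bS ab; have [J maxJ sSJ] := extend_max iS.
exact: (pair_no_cross maxJ sSJ aS bS ab (pair_shared0 maxJ sSJ aS bS ab)).
Qed.

(* The subgraph on S and the shared vertices would be well-covered without
   isolated vertices, yet with fewer shared vertices than #|S|. *)
Lemma card_violator : #|S| = 1.
Proof.
have [a aS] : exists a, a \in S.
  by apply/set0Pn; apply: contraL violS => /eqP->; rewrite cards0 muln0.
apply/eqP; apply: contraT => S_neq1.
have pa : [set a] \proper S.
  rewrite properEcard sub1set aS cards1 ltn_neqAle eq_sym S_neq1.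
  by apply/card_gt0P; exists a.
(* By minimality [[set a]] dominates at least [p.+1] vertices, only [p] of which are private. *)
have [w /setIP[ws]] : exists w, w \in shared :&: ~: D [set a].
  apply/set0Pn; rewrite -card_gt0.
  have := minS pa; have := card_dominated_shared (proper_sub pa).
  by rewrite cards1; lia.
rewrite in_setC undominated1 negbK => aw.
have [K maxK wK] : {K | maxset (fun K => independent e K && (K \subset shared)) K
                      & [set w] \subset K}.
  by apply: maxset_exists; rewrite independent1 // sub1set.
rewrite sub1set in wK; have /andP[iK /subsetP sK] := maxsetp maxK.
have domK v : v \in shared -> v \notin D K.
  move=> vs; apply/negP=> vD.
  suff /notin_undominated : v \in K by rewrite vD.
  rewrite -(maxsetsup maxK _ (subsetUr [set v] K)) ?setU11 //.
  by rewrite independentU1 // subUset sub1set vs; apply/subsetP.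
(* The aim is [#|S| <= #|K| + #|X| <= #|shared|], against [card_shared]. *)
pose X := S :&: D K.
have iKX : independent e (K :|: X).
  apply: independentU => //; last exact: subsetIr.
  exact: independentS (subsetIl _ _) iS.
have [J maxJ] := extend_max iKX.
have /andP[iJ _] := maxJ; rewrite subUset => /andP[sKJ /subsetP sXJ].
have Jeq u v : u \in J -> v \in J -> cadj u v -> u = v.
  by move=> uJ vJ uv; apply: contraTeq uv; apply: (independentP _ iJ).
have sJ : J :\: D S \subset K :|: X.
  apply/subsetP=> v /setDP[vJ /dominated_cases[/domK/dominatedP[u uK uv]|[b bS vb]]].
    by rewrite -(Jeq u v (subsetP sKJ u uK) vJ uv) in_setU uK.
  have bv : cadj b v by move: vb; rewrite in_private // => /andP[].
  have [bD|bD] := boolP (b \in D K).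
    have bX : b \in X by rewrite in_setI bS.
    by rewrite -(Jeq b v (sXJ b bX) vJ bv) in_setU bX orbT.
  (* Here [K] dominates [b], so the closed neighbourhood of [v] within [D K] lies in
     [private b :\ b], too small for the degree bound. *)
  have vD : v \in D K.
    apply: (subsetP (independent_undominated iJ sKJ)); rewrite in_setD vJ andbT.
    by apply: contraL vb => /sK; apply: shared_not_private.
  have ltp : #|private b :\ b| < p.
    by have := cardsD1 b (private b); rewrite self_private // card_private // => ->.
  have := leq_trans ltp (degree_localized iK vD).
  rewrite ltnNge => /negP[]; apply: subset_leq_card.
  apply/subsetP=> x /setIdP[xD vx]; rewrite in_setD1.
  have xb : x != b by apply: contraNneq bD => <-.
  rewrite xb /=; have [xS|/dominated_cases[/domK|[c cS xc]]] := boolP (x \in D S).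
  - by rewrite (negbTE (private_out bS vb xS)) in vx.
  - by rewrite xD.
  - have [<-//|cb] := eqVneq c b.
    by rewrite (negbTE (no_cross bS cS _ vb xc)) // eq_sym in vx.
have pX : X \proper S.
  apply/properP; split; first exact: subsetIl.
  by exists a; rewrite // in_setI aS; apply/dominatedP; exists w; rewrite // cadjC.
have := minS pX; have := card_dominated_shared (proper_sub pX).
(* [X] dominates no vertex of [K], so minimality at [X] yields [#|X| <= #|shared| - #|K|]. *)
have : #|shared :&: ~: D X| <= #|shared :\: K|.
  apply: subset_leq_card; apply/subsetP=> v /setIP[vs vX]; rewrite in_setD vs andbT.
  apply: contraL vX => vK; rewrite in_setC negbK; apply/undominatedP => u /setIP[_].
  by rewrite cadjC // => /undominatedP; apply.
have sKs : K \subset shared by apply/subsetP.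
have := subset_leq_card sKs; rewrite cardsD (setIidPr sKs).
have := leq_trans (card_dominated_part maxJ iS)
         (leq_trans (subset_leq_card sJ) (leq_card_setU _ _)).
by rewrite mulSn; move: card_shared; clear; lia.
Qed.

(** The dominated set is then a single [private a], and [private_out] forbids edges leaving it. *)
Lemma violator_component x y : #|S| = 1 -> connect e x y ->
  x \in ~: D S -> y \in ~: D S.
Proof.
move=> /eqP/cards1P[a Sa]; have aS : a \in S by rewrite Sa set11.
have ->: ~: D S = private a.
  apply/setP=> v; rewrite in_private // {2}Sa setDv in_setC Sa undominated1 negbK.
  by apply/esym/andb_idl => _; apply/undominatedP=> u; rewrite inE.
case/connectP=> s; elim: s x => [|z s IH] x /=; first by move=> _ ->.
case/andP=> exz ps ey xP; apply: (IH z) => //.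
have : z \notin D S.
  by apply/negP=> /(private_out aS xP); rewrite /cadj exz orbT.
case/dominatedP=> u uS uz; move: (uS) uz; rewrite Sa => /set1P-> az.
rewrite in_private // az andbT; apply/undominatedP=> u'.
by rewrite Sa setDv inE.
Qed.

End MinimalViolator.

(** * The lower bound and the equivalence *)

Lemma dominated_lower_bound S : p <> 2 -> connected_graph e ->
  p.+1 * alpha e <= #|T| -> independent e S -> p.+1 * #|S| <= #|~: D S|.
Proof.
move=> p2 [_ conn] large.
elim: {S}#|S| {-2}S (leqnn #|S|) => [|n IHn] S.
  by rewrite leqn0 => /eqP->; rewrite muln0.
move=> leSn iS; rewrite leqNgt; apply/negP=> violS.
have minS X : X \proper S -> p.+1 * #|X| <= #|~: D X|.
  move=> pX; apply: IHn; first by have := proper_card pX; lia.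
  exact: independentS (proper_sub pX) iS.
have S1 := card_violator iS minS violS p2.
have /card_gt0P[a aS] : 0 < #|S| by rewrite S1.
have aD : a \in ~: D S by rewrite in_setC notin_undominated.
have : #|T| <= #|~: D S|.
  rewrite -cardsT; apply: subset_leq_card; apply/subsetP=> y _.
  exact: (violator_component iS minS violS S1 (conn a y) aD).
(* Now [#|T| < p.+1], whereas [alpha e >= 1] and the size hypothesis give [p.+1 <= #|T|]. *)
move: violS; rewrite S1; have := card_independent (independent1 a).
by rewrite cards1; nia.
Qed.

End Wp.
End Domination.

Theorem theorem2p8 (R : realFieldType) (T : finType) (e : rel T)
  (e_sym : symmetric e) (e_irr : irreflexive e)
  (p : nat) (p_gt0 : 0 < p) (p_neq2 : p <> 2) :
  connected_graph e -> W_graph e p ->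
  (quasi_regularizable e (p%:R : R)%R <-> (p + 1) * alpha e <= #|T|).
Proof.
move=> conn GW.
have natE S : independent e S -> (p%:R * #|S|%:R <= #|nbhd e S|%:R :> R)%R
    = (p.+1 * #|S| <= #|~: undominated e S|).
  move=> iS; rewrite -GRing.natrM Num.Theory.ler_nat card_dominated //.
  by rewrite mulSn leq_add2l.
split=> [qr|large S iS].
(* The inequality is applied to one maximum independent set, whose closed neighbourhood has at most
   [#|T|] vertices. *)
- have [J maxJ _] := extend_max e_irr p_gt0 GW (independent0 e_irr).
  have /andP[iJ /eqP <-] := maxJ; move: (qr J iJ); rewrite natE // addn1.
  by move/leq_trans; apply; rewrite max_card.
- rewrite natE //; apply: dominated_lower_bound GW _ p_neq2 conn _ iS => //.
  by rewrite -addn1.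
Qed.
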